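(* Let $\omega=(T,c,T_1,\dots,T_m,c_1,\dots,c_m,\alpha_1,\dots,\alpha_m)\in\Omega$ be such that $\langle x,Tx\rangle$ is a Legendre form on $\mathcal H$. Then the set-valued map $\mathrm{Sol}(\cdot):\Omega\rightrightarrows\mathcal H$ is lower semicontinuous at $\omega$ if and only if the following three conditions are satisfied: (i) $\mathrm{Sol}(QPR_\omega)=\{0\}$; (ii) the system $g_i(x,\omega)\leqslant 0$, $i=1,\dots,m$, is regular; (iii) the set $\mathrm{Sol}(\omega)$ is a singleton.
   Context: $\mathcal H$ is a real Hilbert space with inner product $\langle\cdot,\cdot\rangle$ and norm $\|\cdot\|$; $\mathcal L(\mathcal H)$ is the space of continuous linear operators on $\mathcal H$ with the operator norm; $m\geqslant 1$ is a fixed integer. $\Omega$ is the set of all $\omega=(T,c,T_1,\dots,T_m,c_1,\dots,c_m,\alpha_1,\dots,\alpha_m)\in \mathcal L(\mathcal H)\times\mathcal H\times\mathcal L(\mathcal H)^m\times\mathcal H^m\times\mathbb R^m$ such that $T$ is self-adjoint and each $T_i$ is self-adjoint and positive semidefinite. Product spaces carry the max norm, so $\|\omega-\omega'\|$ is the maximum of the norms of the componentwise differences. For $\omega\in\Omega$ and $x\in\mathcal H$: $f(x,\omega)=\frac12\langle x,Tx\rangle+\langle c,x\rangle$; $g_i(x,\omega)=\frac12\langle x,T_ix\rangle+\langle c_i,x\rangle+\alpha_i$ for $i=1,\dots,m$; $F(\omega)=\{x\in\mathcal H: g_i(x,\omega)\leqslant 0,\ i=1,\dots,m\}$. The optimal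 value function is $\varphi(\omega)=\inf\{f(x,\omega):x\in F(\omega)\}$ (possibly $-\infty$) if $F(\omega)\ne\emptyset$, and $\varphi(\omega)=+\infty$ if $F(\omega)=\emptyset$. The solution set is $\mathrm{Sol}(\omega)=\{x\in F(\omega): f(x,\omega)=\varphi(\omega)\}$. The recession cone of the constraint set is $0^+F(\omega)=\{v\in\mathcal H: T_iv=0,\ \langle c_i,v\rangle\leqslant 0,\ i=1,\dots,m\}$. $(QPR_\omega)$ is the problem of minimizing $\frac12\langle v,Tv\rangle$ over $v\in 0^+F(\omega)$, and $\mathrm{Sol}(QPR_\omega)$ is its set of (global) minimizers. The system $g_i(x,\omega)\leqslant0$, $i=1,\dots,m$, is regular if there is $x^0\in\mathcal H$ with $g_i(x^0,\omega)<0$ for all $i=1,\dots,m$. A quadratic form $Q:\mathcal H\to\mathbb R$ is a Legendre form if it is weakly (sequentially) lower semicontinuous and $x_k\to x_0$ in norm whenever $x_k$ converges weakly to $x_0$ and $Q(x_k)\to Q(x_0)$. A set-valued map $S$ into $\mathcal H$ is lower semicontinuous at $\omega\in\Omega$ if for each (norm-)open $V\subset\mathcal H$ with $S(\omega)\cap V\ne\emptyset$ there is $\varepsilon>0$ such that $S(\omega')\cap V\neq\emptyset$ for all $\omega'\in\Omega$ with $\|\omega'-\omega\|<\varepsilon$.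
   Formalization: Lower semicontinuity of Sol at ω is taken together with Sol(ω) being nonempty: if Sol(ω) is empty (e.g. H=ℝ, T=0, c=1, T_1=0, c_1=0, α_1=−1) it holds vacuously while (iii) fails, so the literal ''only if'' is false. *)

(* Defs.v *)
From HB Require Import structures.
From mathcomp Require Import all_boot all_order all_algebra.
From mathcomp Require Import all_classical all_reals all_analysis.

Set Implicit Arguments.
Unset Strict Implicit.
Unset Printing Implicit Defensive.

Import Order.TTheory GRing.Theory Num.Theory.
Import numFieldNormedType.Exports.

Local Open Scope classical_set_scope.
Local Open Scope ring_scope.

(* A real Hilbert space is a complete normed module H over R together with a
   positive definite symmetric bilinear form ip inducing the norm of H. *)
Definition induces_norm (R : realType) (H : completeNormedModType R)
    (ip : {dot H for idfun}) : Prop :=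
  forall x : H, `|x| ^+ 2 = ip x x.

Definition opnorm (R : realType) (H : completeNormedModType R)
    (A : H -> H) : R :=
  sup [set `|A x| | x in [set x : H | `|x| <= 1]].

(* The tuple (T, c, T_1, ..., T_m, c_1, ..., c_m, alpha_1, ..., alpha_m);
   continuity, self-adjointness and positivity are imposed by Omega below. *)
Record qp_data (R : realType) (H : completeNormedModType R) (m : nat) :=
  QPData {
    qpT : {linear H -> H};
    qpc : H;
    qpTi : 'I_m -> {linear H -> H};
    qpci : 'I_m -> H;
    qpalpha : 'I_m -> R
  }.

Section QuadraticProgram.
Context (R : realType) (H : completeNormedModType R) (ip : {dot H for idfun}).

Definition self_adjoint (A : H -> H) : Prop :=
  forall x y : H, ip (A x) y = ip x (A y).

Definition pos_semidef (A : H -> H) : Prop := forall x : H, 0 <= ip x (A x).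

Definition weak_cvg (x : nat -> H) (x0 : H) : Prop :=
  forall y : H, (fun k => ip y (x k)) @ \oo --> ip y x0.

Definition weakly_lsc (Q : H -> R) : Prop :=
  forall (x : nat -> H) (x0 : H), weak_cvg x x0 ->
    ((Q x0)%:E <= limn_einf (fun k => (Q (x k))%:E))%E.

Definition legendre_form (Q : H -> R) : Prop :=
  weakly_lsc Q /\
  forall (x : nat -> H) (x0 : H), weak_cvg x x0 ->
    (fun k => Q (x k)) @ \oo --> Q x0 -> x @ \oo --> x0.

Context (m : nat).
Implicit Type w : qp_data H m.

Definition Omega : set (qp_data H m) := [set w |
  [/\ continuous (qpT w), self_adjoint (qpT w) &
      forall i, [/\ continuous (qpTi w i), self_adjoint (qpTi w i) &
                    pos_semidef (qpTi w i)]]].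

Definition qp_dist w w' : R :=
  Num.max (opnorm (fun x => qpT w x - qpT w' x))
 (Num.max `|qpc w - qpc w'|
 (Num.max (\big[Num.max/0]_(i < m) opnorm (fun x => qpTi w i x - qpTi w' i x))
 (Num.max (\big[Num.max/0]_(i < m) `|qpci w i - qpci w' i|)
          (\big[Num.max/0]_(i < m) `|qpalpha w i - qpalpha w' i|)))).

Definition objective w (x : H) : R := 2^-1 * ip x (qpT w x) + ip (qpc w) x.

Definition constraint w (i : 'I_m) (x : H) : R :=
  2^-1 * ip x (qpTi w i x) + ip (qpci w i) x + qpalpha w i.

Definition feasible w : set H := [set x | forall i, constraint w i x <= 0].

(* ereal_inf set0 = +oo, which is the convention for an empty feasible set. *)
Definition optimal_value w : \bar R :=
  ereal_inf [set (objective w x)%:E | x in feasible w].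

Definition Sol w : set H :=
  [set x | feasible w x /\ (objective w x)%:E = optimal_value w].

Definition recession_cone w : set H :=
  [set v | forall i, qpTi w i v = 0 /\ ip (qpci w i) v <= 0].

Definition Sol_QPR w : set H :=
  [set v | recession_cone w v /\
    forall u, recession_cone w u ->
      2^-1 * ip v (qpT w v) <= 2^-1 * ip u (qpT w u)].

Definition regular_system w : Prop :=
  exists x0 : H, forall i, constraint w i x0 < 0.

Definition lsc_at (S : qp_data H m -> set H) w : Prop :=
  forall V : set H, open V -> S w `&` V !=set0 ->
    exists2 eps : R, 0 < eps &
      forall w', Omega w' -> qp_dist w' w < eps -> S w' `&` V !=set0.

End QuadraticProgram.

(* Main.v *)
Require Import Defs.
From HB Require Import structures.
From mathcomp Require Import all_boot all_order all_algebra.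
From mathcomp Require Import all_classical all_reals all_analysis.
From mathcomp Require Import ring lra.

Set Implicit Arguments.
Unset Strict Implicit.
Unset Printing Implicit Defensive.

Import Order.TTheory GRing.Theory Num.Theory.
Import numFieldNormedType.Exports.

Local Open Scope classical_set_scope.
Local Open Scope ring_scope.

(** Sufficiency. The Legendre hypothesis is used through one quantitative
    consequence, [legendre_coercive_mod]: up to finitely many squared
    coordinates, the form [<x, T x>] dominates [a |x|^2] for some [a > 0]. This
    inequality persists for operators close to [T], and along a weakly
    convergent family the finitely many coordinates converge, so the form is
    weakly lower semicontinuous, and convergence of its values forces strong
    convergence ([quad_weak_estimate]). Weak limits are taken along
    ultrafilters, where every bounded family has one ([weak_ultra_limit]) and no
    subsequences have to be extracted.

    If [Sol_QPR ip w = [set 0]], then feasible points with bounded objective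
    value are bounded, uniformly in the problems close to [w]: otherwise their
    directions would accumulate at a recession direction [z] with
    [<z, T z> <= 0], hence at [0], and strongly, although they are unit vectors
    ([sublevel_bounded]). Regularity provides a point that remains feasible
    under small perturbations, so nearby problems have solutions
    ([Sol_nonempty]), all in a fixed ball; and any ultrafilter limit of such
    solutions is a strong limit belonging to [Sol ip w] ([Sol_ultra_limit]).
    When [Sol ip w] is a single point, this limit lies in every open set that
    meets [Sol ip w].

    Necessity. Each condition is tested against one perturbation of the data,
    arbitrarily small: raising the [alpha_i] empties the feasible set of a
    system that is not regular ([lsc_regular]); tilting [c] drives the solutions
    away from one of two distinct ones ([lsc_Sol_subsingleton]); replacing [T]
    by [T - d id] makes the problem unbounded along a nonzero recession
    direction [v] with [<v, T v> <= 0] ([lsc_recession_pos]). *)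

(** * Weak limits along ultrafilters *)

Section InnerProduct.
Context (R : realType) (H : completeNormedModType R).
Context (ip : {dot H for idfun}) (ip_norm : induces_norm ip).

Lemma cvg_ext (I : Type) (F : set_system I) (f h : I -> R) (l : R) :
  f =1 h -> h @ F --> l -> f @ F --> l.
Proof. by move=> /funext ->. Qed.

Lemma cvg_sqr (I : Type) (F : set_system I) {FF : Filter F} (f : I -> R)
    (l : R) : f @ F --> l -> f k ^+ 2 @[k --> F] --> l ^+ 2.
Proof. by move=> fl; exact: (cvgM fl fl). Qed.

Lemma ipC x y : ip x y = ip y x.
Proof. by rewrite hermC /= expr0 mul1r. Qed.

Lemma ipDl x y z : ip (x + y) z = ip x z + ip y z.
Proof. by rewrite linearDl. Qed.

Lemma ipDr x y z : ip x (y + z) = ip x y + ip x z.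
Proof. by rewrite linearD. Qed.

Lemma ipZl a x z : ip (a *: x) z = a * ip x z.
Proof. by rewrite linearZl_LR. Qed.

Lemma ipZr a x z : ip x (a *: z) = a * ip x z.
Proof. by rewrite linearZr_LR. Qed.

Lemma ipNl x y : ip (- x) y = - ip x y.
Proof. by rewrite -scaleN1r ipZl mulN1r. Qed.

Lemma ipNr x y : ip x (- y) = - ip x y.
Proof. by rewrite -scaleN1r ipZr mulN1r. Qed.

Lemma ip0r x : ip x 0 = 0.
Proof. by rewrite linear0. Qed.

Lemma ip0l x : ip 0 x = 0.
Proof. by rewrite ipC ip0r. Qed.

Definition ipE := (ipDl, ipDr, ipZl, ipZr, ipNl, ipNr).

Lemma ip_eq0 x : ip x x = 0 -> x = 0.
Proof. by rewrite -ip_norm => /eqP; rewrite sqrf_eq0 normr_eq0 => /eqP. Qed.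

(** Turns a minimality inequality along a line into the vanishing of the first
    variation. *)
Lemma quadratic_ge0_lin_eq0 (a b : R) :
  (forall t, 0 <= t ^+ 2 * a + t * b) -> b = 0.
Proof.
move=> h; have h1 : 0 < `|a| + 1 by rewrite ltr_pwDr.
(* The test value [t = - b / (|a| + 1)] works whatever the sign of [a]. *)
apply/eqP; rewrite -sqrf_eq0 eq_le sqr_ge0 andbT.
have /(_ (- b / (`|a| + 1))) := h.
have -> : (- b / (`|a| + 1)) ^+ 2 * a + (- b / (`|a| + 1)) * b =
    (b ^+ 2 * (a - `|a| - 1)) / (`|a| + 1) ^+ 2 by field; rewrite gt_eqF.
rewrite pmulr_lge0 ?invr_gt0 ?exprn_gt0// => h2.
have h3 := ler_norm a; have := sqr_ge0 b.
nra.
Qed.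

Lemma cauchy_schwarz x y : `|ip x y| <= `|x| * `|y|.
Proof.
have [->|y0] := eqVneq y 0; first by rewrite ip0r !normr0 mulr0.
have yy : 0 < ip y y by rewrite -ip_norm exprn_gt0// normr_gt0.
have : 0 <= ip (ip y y *: x - ip x y *: y) (ip y y *: x - ip x y *: y).
  by rewrite -ip_norm sqr_ge0.
rewrite !ipE (ipC y x) => h.
have {}h : 0 <= ip y y * (ip x x * ip y y - ip x y ^+ 2).
  by apply: le_trans h _; rewrite le_eqVlt; apply/orP; left; apply/eqP; ring.
rewrite -ler_sqr ?nnegrE ?mulr_ge0// exprMn !ip_norm real_normK ?num_real//.
by rewrite pmulr_rge0// subr_ge0 in h.
Qed.

Lemma ip_le x y : ip x y <= `|x| * `|y|.
Proof. exact: le_trans (ler_norm _) (cauchy_schwarz x y). Qed.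

Lemma ip_ge x y : - (`|x| * `|y|) <= ip x y.
Proof. by rewrite lerNl -ipNl (le_trans (ip_le _ _))// normrN. Qed.

Lemma ip_cvg (I : Type) (F : set_system I) {FF : Filter F} (x : I -> H) z y :
  x @ F --> z -> ip y (x k) @[k --> F] --> ip y z.
Proof.
move=> xz; apply/cvgrPdist_le => e e0.
have y1 : 0 < `|y| + 1 by rewrite ltr_pwDr.
have /cvgrPdist_le/(_ (e / (`|y| + 1))) := xz.
rewrite divr_gt0// => /(_ isT); apply: filterS => k xk.
rewrite -ipNr -ipDr (le_trans (cauchy_schwarz _ _))//.
rewrite ler_pdivlMr// mulrC in xk; rewrite (le_trans _ xk)//.
by rewrite ler_wpM2r// lerDl.
Qed.

(** The representative minimizes [|y|^2 - 2 l y]: the parallelogram identity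
    makes minimizing sequences Cauchy, and the first variation vanishes at
    their limit. *)
Lemma riesz_representation (l : H -> R) (N : R) : scalar l ->
  (forall y, `|l y| <= N * `|y|) -> exists z, forall y, l y = ip y z.
Proof.
move=> l_lin l_bd.
have lE t y w : l (y + t *: w) = l y + t * l w.
  by rewrite addrC l_lin addrC.
pose J y := ip y y - 2 * l y.
have J_ge y : - N ^+ 2 <= J y.
  have := ler_norm (l y); have := l_bd y; have := sqr_ge0 (`|y| - N).
  by rewrite /J -ip_norm sqrrB; lra.
have J_inf : has_inf (range J).
  by split; [exists (J 0), 0|exists (- N ^+ 2) => _ [y _ <-]].
have J_min y : inf (range J) <= J y by apply: ge_inf; [case: J_inf|exists y].
have /choice [u u_min] (n : nat) :
    exists y, J y < inf (range J) + n.+1%:R^-1.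
  have n0 : 0 < n.+1%:R^-1 :> R by rewrite invr_gt0.
  by have [_ [y _ <-] Jy] := inf_adherent n0 J_inf; exists y.
have u_close n k : `|u n - u k| ^+ 2 <= 2 * (n.+1%:R^-1 + k.+1%:R^-1).
  have := u_min n; have := u_min k; have := J_min (u n + 2^-1 *: (u k - u n)).
  have ul : l (u k - u n) = l (u k) - l (u n).
    by rewrite -scaleN1r lE mulN1r.
  rewrite ip_norm /J lE ul !ipE (ipC (u k) (u n)).
  move: n.+1%:R^-1 k.+1%:R^-1 (inf _) => a b m.
  lra.
have u_cauchy : cauchy (u @ \oo).
  apply/cauchy_ballP => _/posnumP[e]; rewrite near_map2.
  have h : \forall n \near \oo, n.+1%:R^-1 < e%:num ^+ 2 / 4.
    exact: (near_infty_natSinv_lt (e%:num ^+ 2 / 4)%:pos).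
  near=> n k; rewrite -ball_normE /ball_ /= -ltr_sqr ?nnegrE//.
  apply: le_lt_trans (u_close _ _) _.
  have : n.+1%:R^-1 < e%:num ^+ 2 / 4 by near: n.
  have : k.+1%:R^-1 < e%:num ^+ 2 / 4 by near: k.
  by move: n.+1%:R^-1 k.+1%:R^-1 => a b; lra.
have /cauchy_cvgP/cvg_ex[z uz] := u_cauchy.
exists z => w; apply/esym/eqP; rewrite -subr_eq0; apply/eqP.
suff /quadratic_ge0_lin_eq0 :
    forall t, 0 <= t ^+ 2 * ip w w + t * (2 * (ip w z - l w)).
  by move/eqP; rewrite mulf_eq0 pnatr_eq0 /= => /eqP.
move=> t.
have cv : t ^+ 2 * ip w w + t * (2 * (ip w (u n) - l w)) + n.+1%:R^-1
    @[n --> \oo] --> t ^+ 2 * ip w w + t * (2 * (ip w z - l w)) + 0.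
  apply: cvgD; last exact: cvg_harmonic.
  apply: cvgD; first exact: cvg_cst.
  apply: cvgMr; apply: cvgMr; apply: cvgB; last exact: cvg_cst.
  exact: ip_cvg.
rewrite addr0 in cv; apply: (cvgr_to_ge cv).
apply: nearW => n /=.
have := J_min (u n + t *: w); have := u_min n.
by rewrite /J lE !ipE (ipC (u n) w); move: n.+1%:R^-1 (inf _) => a m; lra.
Unshelve. all: by end_near. Qed.

(** A cluster point of the values exists by compactness, and an ultrafilter
    converges to its cluster points. *)
Lemma ultra_cvg_bounded (I : Type) (U : set_system I) (f : I -> R) (N : R) :
  UltraFilter U -> (forall k, `|f k| <= N) -> exists l : R, f @ U --> l.
Proof.
move=> UU fN.
have [l [_ fl]] : `[-N, N] `&` cluster (f @ U) !=set0.
  apply: (segment_compact (a := - N) (b := N)).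
  by apply: nearW => k; rewrite /= in_itv/= -ler_norml.
exists l => A Al; have [//|UA] := in_ultra_setVsetC (f @^-1` A) UU.
by have [y []] := fl (~` A) A UA Al.
Qed.

(** Weak compactness of balls, along ultrafilters: the limits of the scalar
    products form a bounded functional, which Riesz represents. *)
Lemma weak_ultra_limit (I : Type) (U : set_system I) (x : I -> H) (N : R) :
  UltraFilter U -> (forall k, `|x k| <= N) ->
  exists z, forall y, ip y (x k) @[k --> U] --> ip y z.
Proof.
move=> UU xN.
have bd y k : `|ip y (x k)| <= N * `|y|.
  by rewrite (le_trans (cauchy_schwarz _ _))// mulrC ler_wpM2r.
have /choice [l lP] y : exists l : R, ip y (x k) @[k --> U] --> l.
  exact: ultra_cvg_bounded (bd y).
have [||z lz] := @riesz_representation l N.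
- move=> a y w.
  have : ip (a *: y + w) (x k) @[k --> U] --> a * l y + l w.
    by under eq_cvg do rewrite ipDl ipZl; apply: cvgD => //; apply: cvgMr.
  by move: (lP (a *: y + w)) => c1 c2; exact: (cvg_unique _ c1 c2).
- move=> y; have /cvg_norm nl := lP y.
  by apply: (cvgr_to_le nl); apply: nearW.
- by exists z => y; rewrite -lz.
Qed.


(** * Quadratic functions coercive modulo finitely many directions *)

(** The objective and the constraints all have this form, so that each estimate
    is needed only once. *)
Definition quad (A : H -> H) (b : H) (g : R) (x : H) : R :=
  2^-1 * ip x (A x) + ip b x + g.

Lemma quadD (A : {linear H -> H}) b g z d : self_adjoint ip A ->
  quad A b g (z + d) = quad A b g z + ip (A z + b) d + 2^-1 * ip d (A d).
Proof.
move=> sA; rewrite /quad linearD !ipE (ipC d (A z)) (sA z d).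
by field.
Qed.

(** The quantitative content of being a Legendre form. Unlike the Legendre
    property itself, it is visibly stable under small perturbations of [A]. *)
Definition coercive_mod (a : R) (A : H -> H) : Prop :=
  exists (s : seq H) (C : R), forall x,
    a * `|x| ^+ 2 <= ip x (A x) + C * \sum_(e <- s) ip e x ^+ 2.

Lemma pos_semidef_coercive_mod A : pos_semidef ip A -> coercive_mod 0 A.
Proof.
by move=> A0; exists [::], 0 => x; rewrite !mul0r addr0.
Qed.

Lemma coercive_mod_le a a' A : a' <= a -> coercive_mod a A -> coercive_mod a' A.
Proof.
move=> aa' [s [C sC]]; exists s, C => x; apply: le_trans (sC x).
by rewrite ler_wpM2r// sqr_ge0.
Qed.

Lemma coercive_mod_perturb a e A A' : (forall x, `|A' x - A x| <= e * `|x|) ->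
  coercive_mod a A -> coercive_mod (a - e) A'.
Proof.
move=> AA' [s [C sC]]; exists s, C => x.
have := sC x; have := ip_ge x (A' x - A x); rewrite ipDr ipNr.
have := ler_wpM2l (normr_ge0 x) (AA' x).
rewrite mulrBl expr2 -!(mulrCA `|x|).
lra.
Qed.

(** With [d k = x k - z], the quadratic part of [quad A b g (x k)] around [z]
    dominates [a / 2 |d k|^2] up to finitely many squared coordinates of [d k],
    and these, like the linear part, vanish in the weak limit. *)
Lemma quad_weak_estimate (I : Type) (F : set_system I) {FF : ProperFilter F}
    (A : {linear H -> H}) (a : R) b g (x : I -> H) z (r : I -> R) (r0 : R) :
    self_adjoint ip A -> coercive_mod a A ->
    (forall y, ip y (x k) @[k --> F] --> ip y z) ->
    r @ F --> r0 -> (\forall k \near F, quad A b g (x k) <= r k) ->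
  exists2 s : I -> R, s @ F --> r0 - quad A b g z &
    \forall k \near F, a / 2 * `|x k - z| ^+ 2 <= s k.
Proof.
move=> sA [t [C tC]] xz rr xr.
pose S k := \sum_(e <- t) ip e (x k - z) ^+ 2.
have dz y : ip y (x k - z) @[k --> F] --> (0 : R).
  rewrite -(subrr (ip y z)).
  apply: (cvg_ext (h := fun k => ip y (x k) - ip y z)).
    by move=> k; rewrite ipDr ipNr.
  by apply: cvgB => //; exact: cvg_cst.
have S0 : S @ F --> (0 : R).
  rewrite /S; elim: t {tC S} => [|e t IHt].
    apply: (cvg_ext (h := fun=> 0)); last exact: cvg_cst.
    by move=> k; rewrite big_nil.
  apply: (cvg_ext (h := fun k => ip e (x k - z) * ip e (x k - z) +
      \sum_(e0 <- t) ip e0 (x k - z) ^+ 2)).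
    by move=> k; rewrite big_cons expr2.
  rewrite -[X in _ --> X](addr0 0) -[X in _ --> X + _](mul0r 0).
  by apply: cvgD => //; apply: cvgM.
exists (fun k => r k - quad A b g z - ip (A z + b) (x k - z) + C / 2 * S k).
  rewrite -[X in _ --> X]addr0 -[X in _ --> X + _]subr0.
  rewrite -[X in _ --> _ + X](mulr0 (C / 2)).
  apply: cvgD; last exact: cvgMr.
  apply: cvgB => //; apply: cvgB => //; exact: cvg_cst.
apply: filterS xr => k; have := tC (x k - z).
have -> : quad A b g (x k) = quad A b g (z + (x k - z)) by rewrite addrC subrK.
rewrite quadD// -/(S k).
lra.
Qed.

(** The case [a = 0] of the estimate. *)
Lemma quad_weak_lsc (I : Type) (F : set_system I) {FF : ProperFilter F}
    (A : {linear H -> H}) b g (x : I -> H) z (r : I -> R) (r0 : R) :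
    self_adjoint ip A -> coercive_mod 0 A ->
    (forall y, ip y (x k) @[k --> F] --> ip y z) ->
    r @ F --> r0 -> (\forall k \near F, quad A b g (x k) <= r k) ->
  quad A b g z <= r0.
Proof.
move=> sA cA xz rr xr.
have [s sl sP] := quad_weak_estimate sA cA xz rr xr.
rewrite -subr_ge0; apply: (cvgr_to_ge sl); apply: filterS sP => k.
by rewrite !mul0r.
Qed.

(** The case [0 < a]: the squared distances to [z] are then bounded by a family
    with a nonpositive limit. *)
Lemma quad_strong_cvg (I : Type) (F : set_system I) {FF : ProperFilter F}
    (A : {linear H -> H}) (a : R) b g (x : I -> H) z (r : I -> R) (r0 : R) :
    0 < a -> self_adjoint ip A -> coercive_mod a A ->
    (forall y, ip y (x k) @[k --> F] --> ip y z) ->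
    r @ F --> r0 -> (\forall k \near F, quad A b g (x k) <= r k) ->
  r0 <= quad A b g z -> x @ F --> z.
Proof.
move=> a0 sA cA xz rr xr r0q.
have [s sl sP] := quad_weak_estimate sA cA xz rr xr.
apply/cvgrPdist_lt => e e0.
have ae : 0 < a / 2 * e ^+ 2 by rewrite mulr_gt0 ?divr_gt0 ?exprn_gt0.
have s_lt : \forall k \near F, s k < a / 2 * e ^+ 2.
  by apply: (cvgr_lt _ sl); rewrite (le_lt_trans _ ae)// subr_le0.
apply: filterS2 sP s_lt => k h1 h2; rewrite distrC.
rewrite -ltr_sqr ?nnegrE ?(ltW e0)// -(ltr_pM2l (x := a / 2)) ?divr_gt0//.
exact: le_lt_trans h1 h2.
Qed.

Lemma continuous_linear_le (A : {linear H -> H}) : continuous A ->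
  exists2 K : R, 0 <= K & forall x, `|A x| <= K * `|x|.
Proof.
move=> /linear_bounded_continuous/linear_boundedP/pinfty_ex_gt0[K K0 AK].
by exists K; [exact: ltW|].
Qed.

(** Such an [x] minimizes the form, so its first variation in the direction
    [A x] vanishes. *)
Lemma pos_semidef_ker (A : {linear H -> H}) x : self_adjoint ip A ->
  pos_semidef ip A -> ip x (A x) <= 0 -> A x = 0.
Proof.
move=> sA A0 Ax0; have {}Ax0 : ip x (A x) = 0.
  by apply/eqP; rewrite eq_le Ax0 A0.
apply: ip_eq0; suff /quadratic_ge0_lin_eq0 :
    forall t, 0 <= t ^+ 2 * ip (A x) (A (A x)) + t * (2 * ip (A x) (A x)).
  by move/eqP; rewrite mulf_eq0 pnatr_eq0 /= => /eqP.
move=> t; apply: le_trans (A0 (x + t *: A x)) _.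
rewrite [A (_ + _)]linearD [A (_ *: _)]linearZ /= !ipE Ax0 (sA x).
by rewrite le_eqVlt; apply/orP; left; apply/eqP; ring.
Qed.

Lemma quad_line (A : {linear H -> H}) b g y d t : self_adjoint ip A ->
  quad A b g (y + t *: d) =
  quad A b g y + t * ip (A y + b) d + t ^+ 2 * (2^-1 * ip d (A d)).
Proof. by move=> sA; rewrite quadD// [A (_ *: _)]linearZ /= !ipE; ring. Qed.

(** With [d = y0 - y], the two sides differ by [t (1 - t) / 2 <d, A d>]. *)
Lemma quad_convex (A : {linear H -> H}) b g y y0 t : self_adjoint ip A ->
  pos_semidef ip A -> 0 <= t <= 1 ->
  quad A b g (y + t *: (y0 - y)) <= (1 - t) * quad A b g y + t * quad A b g y0.
Proof.
move=> sA A0 /andP[t0 t1].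
have -> : quad A b g y0 = quad A b g (y + 1 *: (y0 - y)).
  by rewrite scale1r addrC subrK.
rewrite !quad_line//; have := A0 (y0 - y).
set q := ip _ (A _); set L := ip _ _; set Q := quad _ _ _ _ => q0.
have : 0 <= t * (1 - t) * q by rewrite !mulr_ge0// subr_ge0.
lra.
Qed.

Lemma quad_dist A A' b b' g g' e x : 0 <= e ->
  `|A x - A' x| <= e * `|x| -> `|b - b'| <= e -> `|g - g'| <= e ->
  `|quad A b g x - quad A' b' g' x| <= e * (1 + `|x|) ^+ 2.
Proof.
move=> e0 AA bb gg.
have -> : quad A b g x - quad A' b' g' x =
    2^-1 * ip x (A x - A' x) + ip (b - b') x + (g - g').
  by rewrite /quad !ipE; ring.
have h1 : `|ip x (A x - A' x)| <= e * `|x| ^+ 2.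
  apply: le_trans (cauchy_schwarz _ _) _.
  by rewrite expr2 mulrCA ler_wpM2l.
have h2 : `|ip (b - b') x| <= e * `|x|.
  by apply: le_trans (cauchy_schwarz _ _) _; rewrite ler_wpM2r.
have h3 : 0 <= e * `|x| ^+ 2 by rewrite mulr_ge0// sqr_ge0.
have h4 : 0 <= e * `|x| by rewrite mulr_ge0.
move: h1 h2 gg; rewrite !ler_norml => /andP[? ?] /andP[? ?] /andP[? ?].
by apply/andP; split; rewrite sqrrD expr1n mul1r; lra.
Qed.

Lemma quad_bound (A : {linear H -> H}) b g : continuous A ->
  exists2 K : R, 0 <= K & forall x, `|quad A b g x| <= K * (1 + `|x|) ^+ 2.
Proof.
move=> /continuous_linear_le[K K0 AK].
exists (K + `|b| + `|g|); first by rewrite !addr_ge0.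
move=> x; have q0 : quad (fun=> 0) 0 0 x = 0.
  by rewrite /quad ip0r ip0l mulr0 !addr0.
rewrite -[quad _ _ _ _]subr0 -[X in _ - X]q0 quad_dist//.
- by rewrite !addr_ge0.
- rewrite subr0; apply: le_trans (AK x) _; rewrite ler_wpM2r//.
  by rewrite -addrA lerDl addr_ge0.
- by rewrite subr0 addrAC lerDr addr_ge0.
- by rewrite subr0 lerDr addr_ge0.
Qed.

(** * Legendre forms *)

(** Along any ultrafilter finer than [\oo] there is a weak limit, and it is
    orthogonal to every [x i], hence to itself. So no ultrafilter finer than
    [\oo] can keep [<y, x k>] away from [0]. *)
Lemma weak_cvg0_of_gram (x : nat -> H) (N : R) : (forall k, `|x k| <= N) ->
  (forall i, ip (x i) (x k) @[k --> \oo] --> (0 : R)) -> weak_cvg ip x 0.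
Proof.
move=> xN xx y; rewrite ip0r; apply/cvgrPdist_lt => e e0.
pose A := [set k | `|0 - ip y (x k)| < e].
apply: contrapT => nA.
have PF : ProperFilter (within (~` A) \oo).
  apply: Build_ProperFilter_ex.
  move=> B AB; apply: contrapT => nB; apply: nA.
  have {}AB : \forall k \near \oo, (~` A) k -> B k := AB.
  apply: filterS AB => k Bk.
  by apply: contrapT => Ak; apply: nB; exists k; exact: Bk.
(* [U] lives on the indices [k] where [|<y, x k>| >= e]. *)
have [U [UU sU]] := ultraFilterLemma PF.
have ooU : \oo `<=` U.
  by move=> B oB; apply: sU; apply: filterS oB => k Bk _.
have [z zP] := weak_ultra_limit UU xN.
have xz i : ip (x i) z = 0.
  have c1 := zP (x i); have c2 : ip (x i) (x k) @[k --> U] --> (0 : R).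
    by move=> B /(xx i) Bi; exact: (ooU _ Bi).
  exact: (cvg_unique _ c1 c2).
have z0 : z = 0.
  apply: ip_eq0; have c1 := zP z.
  have c2 : ip z (x k) @[k --> U] --> (0 : R).
    apply: (cvg_ext (h := fun=> 0)); last exact: cvg_cst.
    by move=> k; rewrite ipC xz.
  exact: (cvg_unique _ c1 c2).
have UA : U A.
  by have := zP y; rewrite z0 ip0r => /cvgrPdist_lt; exact.
have UnA : U (~` A) by apply: sU; exact: nearW.
by have [k [Ak nAk]] := filter_ex (filterI UA UnA).
Qed.

(** If no finite family of directions makes [A] coercive, then one picks unit
    vectors [v n], almost orthogonal to the previous ones, on which the form
    is at most [1/n]. They tend weakly to [0], so weak lower semicontinuity
    forces the values of the form to tend to [0], and the Legendre property
    gives [v n --> 0] in norm, contradicting [|v n| = 1]. *)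
Lemma legendre_coercive_mod (A : {linear H -> H}) : continuous A ->
  legendre_form ip (fun x => ip x (A x)) ->
  exists2 a : R, 0 < a & coercive_mod a A.
Proof.
move=> cA [A_lsc A_leg]; apply: contrapT => ncoer.
have [K K0 AK] := continuous_linear_le cA.
(* Failure of coercivity modulo [s] with both constants determined by the size
   of [s], so that [a] tends to [0] and [C] to infinity along the
   construction. *)
have /choice [nxt nxtP] (s : seq H) : exists v, `|v| = 1 /\
    ip v (A v) + (size s).+1%:R * \sum_(e <- s) ip e v ^+ 2
      < (size s).+1%:R^-1.
  apply: contrapT => ns; apply: ncoer.
  exists (size s).+1%:R^-1; first by rewrite invr_gt0.
  exists s, (size s).+1%:R => x.
  have [->|x0] := eqVneq x 0.
    rewrite normr0 expr0n mulr0 ip0l add0r mulr_ge0// sumr_ge0// => e _.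
    exact: sqr_ge0.
  have nx : 0 < `|x| by rewrite normr_gt0.
  rewrite leNgt; apply/negP => lt; apply: ns; exists (`|x|^-1 *: x); split.
    by rewrite normrZ normfV normr_id mulVf// gt_eqF.
  rewrite linearZ ipZl ipZr mulrA -expr2.
  under eq_bigr do rewrite ipZr exprMn.
  rewrite -mulr_sumr mulrCA -mulrDr exprVn mulrC ltr_pdivrMr ?exprn_gt0//.
have {nxtP} [nxt1 nxt_lt] := all_and2 nxtP.
pose fam n := iter n (fun s => nxt s :: s) [::].
pose v n := nxt (fam n).
have size_fam n : size (fam n) = n by elim: n => //= n ->.
have fam_in i n : (i < n)%N -> v i \in fam n.
  elim: n => // n IHn; rewrite ltnS leq_eqVlt => /predU1P[->|/IHn vi] /=.
    exact: mem_head.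
  by rewrite inE vi orbT.
have v1 k : `|v k| <= 1 by rewrite nxt1.
have v_lt n : ip (v n) (A (v n)) + n.+1%:R * \sum_(e <- fam n) ip e (v n) ^+ 2
    < n.+1%:R^-1.
  by have := nxt_lt (fam n); rewrite size_fam.
have Av_ge n : - K <= ip (v n) (A (v n)).
  have := ip_ge (v n) (A (v n)); have := AK (v n); rewrite nxt1; lra.
have sum_ge0 (s : seq H) y : 0 <= \sum_(e <- s) ip e y ^+ 2.
  by rewrite sumr_ge0// => e _; exact: sqr_ge0.
have v_gram i n : (i < n)%N -> ip (v i) (v n) ^+ 2 <= (K + 1) * n.+1%:R^-1.
  move=> /fam_in vi.
  have : ip (v i) (v n) ^+ 2 <= \sum_(e <- fam n) ip e (v n) ^+ 2.
    rewrite (perm_big _ (perm_to_rem vi)) big_cons /= lerDl.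
    exact: sum_ge0.
  move=> /le_trans; apply; rewrite ler_pdivlMr// mulrC.
  have := v_lt n; have := Av_ge n.
  have : n.+1%:R^-1 <= 1 :> R by rewrite invf_le1// ler1n.
  move: n.+1%:R^-1 (_ * \sum_(_ <- _) _) => c S.
  lra.
have v0 : weak_cvg ip v 0.
  apply: (weak_cvg0_of_gram v1) => i; apply/cvgrPdist_lt => e e0.
  have e1 : 0 < e ^+ 2 / (K + 1) by rewrite divr_gt0 ?exprn_gt0// ltr_wpDl.
  have h := near_infty_natSinv_lt (PosNum e1).
  near=> n; rewrite sub0r normrN.
  rewrite -ltr_sqr ?nnegrE ?(ltW e0)// real_normK ?num_real//.
  apply: (@le_lt_trans _ _ ((K + 1) * n.+1%:R^-1)).
    by apply: v_gram; near: n; exact: nbhs_infty_gt.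
  rewrite mulrC -ltr_pdivlMr ?ltr_wpDl//.
  by near: n.
have Av0 : ip (v n) (A (v n)) @[n --> \oo] --> ip (0 : H) (A 0).
  rewrite ip0l; apply/cvgrPdist_lt => e e0.
  have := A_lsc _ _ v0.
  rewrite ip0l limn_einf_lim (cvg_lim _ (@cvg_einfs_sup _ _))//.
  have eN0 : ((- e)%:E < 0)%E by rewrite lte_fin oppr_lt0.
  move=> /(lt_le_trans eN0)/ereal_sup_gt[_ [m _ <-] em].
  have h := near_infty_natSinv_lt (PosNum e0).
  near=> n; rewrite sub0r normrN ltr_norml; apply/andP; split.
    rewrite -lte_fin; apply: lt_le_trans em _; apply: ereal_inf_lbound.
    by exists n => //=; near: n; exact: nbhs_infty_ge.
  apply: (@lt_trans _ _ n.+1%:R^-1); last by near: n.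
  by apply: le_lt_trans (v_lt n); rewrite lerDl mulr_ge0.
have /cvg_norm := A_leg _ _ v0 Av0; rewrite normr0.
have c1 : `|v n| @[n --> \oo] --> (1 : R).
  by apply: (cvg_ext (h := fun=> 1)); [move=> n; rewrite nxt1|exact: cvg_cst].
move=> c0; have /eqP : (1 : R) = 0 by exact: (cvg_unique _ c1 c0).
by rewrite oner_eq0.
Unshelve. all: by end_near. Qed.

(** * Perturbation of the data *)

Lemma opnorm_ge (A : {linear H -> H}) x : continuous A ->
  `|A x| <= opnorm A * `|x|.
Proof.
move=> /continuous_linear_le[K K0 AK].
have [->|x0] := eqVneq x 0; first by rewrite linear0 !normr0 mulr0.
have nx : 0 < `|x| by rewrite normr_gt0.
rewrite -ler_pdivrMr//; apply: ub_le_sup.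
  exists K => _ [y /= y1 <-]; apply: le_trans (AK y) _.
  by rewrite ler_piMr.
exists (`|x|^-1 *: x) => /=.
  by rewrite normrZ normfV normr_id mulVf ?gt_eqF.
by rewrite linearZ normrZ normfV normr_id mulrC.
Qed.

Lemma opnorm_le (A : H -> H) K :
  (forall x, `|x| <= 1 -> `|A x| <= K) -> opnorm A <= K.
Proof.
move=> AK; apply: ge_sup.
  by exists `|A 0|, 0 => //=; rewrite normr0.
by move=> _ [x /= x1 <-]; exact: AK.
Qed.

Context (m : nat).
Implicit Type w : qp_data H m.

Lemma qpT_dist w w' x : Omega ip w -> Omega ip w' ->
  `|qpT w x - qpT w' x| <= qp_dist w w' * `|x|.
Proof.
move=> [cT _ _] [cT' _ _].
apply: (@le_trans _ _ (opnorm (fun x => qpT w x - qpT w' x) * `|x|)).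
  apply: (@opnorm_ge (qpT w \- qpT w')) => y.
  by apply: cvgB; [exact: cT|exact: cT'].
by rewrite ler_wpM2r// /qp_dist le_max lexx.
Qed.

Lemma qpc_dist w w' : `|qpc w - qpc w'| <= qp_dist w w'.
Proof. by rewrite /qp_dist !le_max lexx orbT. Qed.

Lemma qp_dist_ge0 w w' : 0 <= qp_dist w w'.
Proof. exact: le_trans (normr_ge0 _) (qpc_dist w w'). Qed.

Lemma qpTi_dist w w' i x : Omega ip w -> Omega ip w' ->
  `|qpTi w i x - qpTi w' i x| <= qp_dist w w' * `|x|.
Proof.
move=> [_ _ Ow] [_ _ Ow']; have [cT _ _] := Ow i; have [cT' _ _] := Ow' i.
apply: (@le_trans _ _ (opnorm (fun x => qpTi w i x - qpTi w' i x) * `|x|)).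
  apply: (@opnorm_ge (qpTi w i \- qpTi w' i)) => y.
  by apply: cvgB; [exact: cT|exact: cT'].
rewrite ler_wpM2r// /qp_dist !le_max; apply/or3P/Or33/orP; left.
exact: (le_bigmax _ (fun i => opnorm (fun x => qpTi w i x - qpTi w' i x))).
Qed.

Lemma qpci_dist w w' i : `|qpci w i - qpci w' i| <= qp_dist w w'.
Proof.
rewrite /qp_dist !le_max; do 3 (apply/orP; right); apply/orP; left.
exact: (le_bigmax _ (fun i => `|qpci w i - qpci w' i|)).
Qed.

Lemma qpalpha_dist w w' i : `|qpalpha w i - qpalpha w' i| <= qp_dist w w'.
Proof.
rewrite /qp_dist !le_max; do 4 (apply/orP; right).
exact: (le_bigmax _ (fun i => `|qpalpha w i - qpalpha w' i|)).
Qed.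

Lemma qp_dist_le w w' e : 0 <= e ->
  opnorm (fun x => qpT w x - qpT w' x) <= e -> `|qpc w - qpc w'| <= e ->
  (forall i, opnorm (fun x => qpTi w i x - qpTi w' i x) <= e) ->
  (forall i, `|qpci w i - qpci w' i| <= e) ->
  (forall i, `|qpalpha w i - qpalpha w' i| <= e) ->
  qp_dist w w' <= e.
Proof.
move=> e0 T_e c_e Ti_e ci_e alpha_e; rewrite /qp_dist !ge_max T_e c_e /=.
by apply/and3P; split; apply: bigmax_le.
Qed.

Lemma objectiveE w x : objective ip w x = quad (qpT w) (qpc w) 0 x.
Proof. by rewrite /quad addr0. Qed.

Lemma objective_dist w w' x : Omega ip w -> Omega ip w' ->
  `|objective ip w x - objective ip w' x| <= qp_dist w w' * (1 + `|x|) ^+ 2.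
Proof.
move=> Ow Ow'; rewrite !objectiveE; apply: quad_dist.
- exact: qp_dist_ge0.
- exact: qpT_dist.
- exact: qpc_dist.
- by rewrite subrr normr0 qp_dist_ge0.
Qed.

Lemma constraint_dist w w' i x : Omega ip w -> Omega ip w' ->
  `|constraint ip w i x - constraint ip w' i x|
    <= qp_dist w w' * (1 + `|x|) ^+ 2.
Proof.
move=> Ow Ow'; apply: quad_dist.
- exact: qp_dist_ge0.
- exact: qpTi_dist.
- exact: qpci_dist.
- exact: qpalpha_dist.
Qed.

Lemma SolP w x : Sol ip w x <->
  feasible ip w x /\
  (forall y, feasible ip w y -> objective ip w x <= objective ip w y).
Proof.
split=> -[wx Px]; split=> //.
  move=> y wy; rewrite -lee_fin Px; apply: ereal_inf_lbound.
  by exists y.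
apply/eqP; rewrite eq_le; apply/andP; split; last first.
  by apply: ereal_inf_lbound; exists x.
by apply: le_ereal_inf_tmp => _ [y wy <-]; rewrite lee_fin Px.
Qed.

(** * Existence, boundedness and limits of solutions *)

(** Coercivity modulo finitely many directions makes the objective weakly
    lower semicontinuous, hence it attains its minimum on a bounded sublevel
    set of the closed convex feasible set. *)
Lemma Sol_nonempty w y N : Omega ip w -> coercive_mod 0 (qpT w) ->
  feasible ip w y ->
  (forall x, feasible ip w x -> objective ip w x <= objective ip w y ->
    `|x| <= N) ->
  Sol ip w !=set0.
Proof.
move=> [cT sT TiP] coT wy bdN.
pose L := [set x | feasible ip w x /\ objective ip w x <= objective ip w y].
have [K K0 fK] := quad_bound (qpc w) 0 cT.
have inf_L : has_inf (objective ip w @` L).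
  split; first by exists (objective ip w y), y.
  exists (- (K * (1 + N) ^+ 2)) => _ [x [wx xy] <-].
  have := fK x; rewrite -objectiveE ler_norml => /andP[+ _].
  apply: le_trans; rewrite lerN2 ler_wpM2l// ler_sqr ?nnegrE.
  - by rewrite lerD2l bdN.
  - by rewrite addr_ge0.
  - by rewrite addr_ge0// (le_trans (normr_ge0 x))// bdN.
set mu := inf (objective ip w @` L).
have mu_le x : feasible ip w x -> mu <= objective ip w x.
  move=> wx; have [xy|/ltW yx] := leP (objective ip w x) (objective ip w y).
    by apply: ge_inf; [case: inf_L|exists x].
  by apply: le_trans yx; apply: ge_inf; [case: inf_L|exists y].
have /choice [x xP] (n : nat) :
    exists x, L x /\ objective ip w x < mu + n.+1%:R^-1.
  have n0 : 0 < n.+1%:R^-1 :> R by rewrite invr_gt0.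
  by have [_ [x Lx <-] xn] := inf_adherent n0 inf_L; exists x.
have [U [UU ooU]] := ultraFilterLemma (F := \oo) _.
have [z zP] : exists z, forall v, ip v (x k) @[k --> U] --> ip v z.
  apply: (weak_ultra_limit UU (N := N)) => k.
  by have [[? ?] _] := xP k; exact: bdN.
exists z; apply/SolP; split=> [i|v wv].
  have [_ sTi Ti0] := TiP i.
  apply: (quad_weak_lsc sTi (pos_semidef_coercive_mod Ti0) zP (cvg_cst 0)).
  by apply: nearW => k; have [[xk _] _] := xP k; exact: xk.
rewrite [leLHS]objectiveE; apply: le_trans (mu_le v wv).
have r_cvg : mu + k.+1%:R^-1 @[k --> U] --> mu.
  apply: (cvg_trans (cvg_app _ ooU)); rewrite -[X in _ --> X]addr0.
  by apply: cvgD; [exact: cvg_cst|exact: cvg_harmonic].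
apply: (quad_weak_lsc sT coT zP r_cvg); apply: nearW => k.
by rewrite -objectiveE ltW//; have [] := xP k.
Qed.

(** Rescaling [x = |x| v] in an approximate inequality [quad A b g x <= B]
    leaves an inequality for the quadratic part at the unit vector [v] whose
    right-hand side vanishes as [|x|] tends to infinity and [e] to [0]. *)
Lemma quad_rescale (A : {linear H -> H}) b g B e x : x != 0 ->
  quad A b g x <= B + e * (1 + `|x|) ^+ 2 ->
  quad A 0 0 (`|x|^-1 *: x) <=
    `|x|^-1 ^+ 2 * (B - g) + e * (`|x|^-1 + 1) ^+ 2
      - `|x|^-1 * ip b (`|x|^-1 *: x).
Proof.
move=> x0; have nx : 0 < `|x| by rewrite normr_gt0.
have tau0 : 0 < `|x|^-1 ^+ 2 by rewrite exprn_gt0// invr_gt0.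
rewrite -(ler_pM2l tau0) {1}/quad mulrDr => h.
rewrite /quad ip0l !addr0 [A (_ *: _)]linearZ /= !ipZr ipZl.
have -> : (`|x|^-1 + 1) ^+ 2 = `|x|^-1 ^+ 2 * (1 + `|x|) ^+ 2.
  by rewrite -exprMn mulrDr mulr1 mulVf ?gt_eqF.
move: h; rewrite !mulrDr expr2; lra.
Qed.

(** Otherwise feasible points [x k] of problems tending to [w] have
    [|x k| --> +oo] and objective values bounded above. Every weak limit [z] of
    their directions lies in the recession cone of [w] and satisfies
    [<z, T z> <= 0], so [z = 0]; coercivity then makes the unit directions
    converge to [0] in norm. *)
Lemma sublevel_bounded w a M : Omega ip w -> 0 < a -> coercive_mod a (qpT w) ->
  (forall v, recession_cone ip w v -> ip v (qpT w v) <= 0 -> v = 0) ->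
  exists2 eps : R, 0 < eps & exists N : R, forall w' x, Omega ip w' ->
    qp_dist w' w < eps -> feasible ip w' x -> objective ip w' x <= M ->
    `|x| <= N.
Proof.
move=> Ow a0 coT recw; apply: contrapT => unbd.
have /choice [p pP] (k : nat) : exists p : qp_data H m * H,
    [/\ Omega ip p.1, qp_dist p.1 w < k.+1%:R^-1, feasible ip p.1 p.2,
        objective ip p.1 p.2 <= M & k.+1%:R < `|p.2|].
  apply: contrapT => np; apply: unbd; exists k.+1%:R^-1.
    by rewrite invr_gt0.
  exists k.+1%:R => w' x Ow' ww' w'x fx; rewrite leNgt; apply/negP => kx.
  by apply: np; exists (w', x).
have [U [UU ooU]] := ultraFilterLemma (F := \oo) _.
pose x k := (p k).2; pose e k := qp_dist (p k).1 w.
pose tau k := `|x k|^-1; pose v k := tau k *: x k.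
have nx k : 0 < `|x k| by have [_ _ _ _] := pP k; apply: lt_trans.
have x0 k : x k != 0 by rewrite -normr_gt0.
have v1 k : `|v k| = 1 by rewrite normrZ normfV normr_id mulVf// gt_eqF.
have vanish (u : nat -> R) : (forall k, 0 <= u k <= k.+1%:R^-1) ->
    u @ U --> (0 : R).
  move=> u_le; apply: (cvg_trans (cvg_app _ ooU)).
  apply: (squeeze_cvgr _ (cvg_cst 0) cvg_harmonic).
  by apply: nearW => k; exact: u_le.
have e_cvg : e @ U --> (0 : R).
  by apply: vanish => k; rewrite qp_dist_ge0 /= ltW//; have [] := pP k.
have tau_cvg : tau @ U --> (0 : R).
  apply: vanish => k; rewrite invr_ge0 normr_ge0 /= lef_pV2 ?posrE//.
  by rewrite ltW//; have [] := pP k.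
have [z zP] : exists z, forall y, ip y (v k) @[k --> U] --> ip y z.
  by apply: (weak_ultra_limit UU (N := 1)) => k; rewrite v1.
have r_cvg B g b : tau k ^+ 2 * (B - g) + e k * (tau k + 1) ^+ 2
    - tau k * ip b (v k) @[k --> U] --> (0 : R).
  have -> : (0 : R) = 0 ^+ 2 * (B - g) + 0 * (0 + 1) ^+ 2 - 0 * ip b z.
    by rewrite expr0n !mul0r !addr0 subr0.
  have tau2 : tau k ^+ 2 @[k --> U] --> (0 : R) ^+ 2 by exact: cvg_sqr.
  have tau1 : (tau k + 1) ^+ 2 @[k --> U] --> (0 + 1 : R) ^+ 2.
    by apply: cvg_sqr; apply: cvgD => //; exact: cvg_cst.
  apply: cvgB; last exact: cvgM tau_cvg (zP b).
  by apply: cvgD; [apply: cvgMl|exact: cvgM].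
have [cT sT TiP] := Ow.
have Tv_le k : quad (qpT w) 0 0 (v k) <=
    tau k ^+ 2 * (M - 0) + e k * (tau k + 1) ^+ 2 - tau k * ip (qpc w) (v k).
  apply: quad_rescale => //; have [Op _ _ fM _] := pP k.
  have := objective_dist (x k) Op Ow; rewrite -objectiveE ler_norml -/(e k).
  by move: fM; rewrite -/(x k) => + /andP[]; lra.
have z_rec : recession_cone ip w z.
  move=> i; have [_ sTi Ti0] := TiP i; split.
    apply: (pos_semidef_ker sTi Ti0).
    have Tiv_le k : quad (qpTi w i) 0 0 (v k) <=
        tau k ^+ 2 * (0 - qpalpha w i) + e k * (tau k + 1) ^+ 2
          - tau k * ip (qpci w i) (v k).
      apply: quad_rescale => //; have [Op _ /(_ i) gx _ _] := pP k.
      have := constraint_dist i (x k) Op Ow; rewrite ler_norml -/(e k).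
      rewrite -[quad _ _ _ _]/(constraint ip w i (x k)).
      by move: gx; rewrite -/(x k) => + /andP[]; lra.
    have : quad (qpTi w i) 0 0 z <= 0.
      by apply: (quad_weak_lsc sTi (pos_semidef_coercive_mod Ti0) zP
        (r_cvg 0 (qpalpha w i) (qpci w i))); exact: nearW.
    by rewrite /quad ip0l !addr0 pmulr_rle0.
  (* The quadratic part of a perturbed constraint is nonnegative and can be
     dropped, which leaves a linear inequality on the direction. *)
  have ci_le k : ip (qpci w i) (v k) <= e k + tau k * (e k - qpalpha w i).
    have [Op _ /(_ i) gx _ _] := pP k.
    have [_ _ /(_ i) [_ _ /(_ (x k)) Tik0]] := Op.
    have := qpalpha_dist (p k).1 w i; rewrite ler_norml -/(e k) => /andP[al _].
    have := ip_ge (qpci (p k).1 i - qpci w i) (x k).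
    have := ler_wpM2r (normr_ge0 (x k)) (qpci_dist (p k).1 w i).
    rewrite ipDl ipNl -/(e k) => ci1 ci2.
    move: gx; rewrite /constraint -/(x k) => gx.
    rewrite /v ipZr -(ler_pM2l (nx k)) mulrA mulfV ?gt_eqF// mul1r.
    rewrite mulrDr mulrA mulfV ?gt_eqF// mul1r.
    lra.
  have ci_cvg : ip (qpci w i) (v k) - (e k + tau k * (e k - qpalpha w i))
      @[k --> U] --> ip (qpci w i) z - (0 + 0 * (0 - qpalpha w i)).
    apply: cvgB => //; apply: cvgD => //; apply: cvgM => //.
    by apply: cvgB => //; exact: cvg_cst.
  rewrite mul0r addr0 subr0 in ci_cvg.
  by apply: (cvgr_to_le ci_cvg); apply: nearW => k; rewrite subr_le0.
have z0 : z = 0.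
  apply: recw => //.
  have : quad (qpT w) 0 0 z <= 0.
    by apply: (quad_weak_lsc sT (coercive_mod_le (ltW a0) coT) zP
      (r_cvg M 0 (qpc w))); exact: nearW.
  by rewrite /quad ip0l !addr0 pmulr_rle0.
have v0 : v @ U --> (0 : H).
  rewrite -z0.
  apply: (quad_strong_cvg a0 sT coT zP (r_cvg M 0 (qpc w)) (b := 0) (g := 0)).
    exact: nearW.
  by rewrite z0 /quad ip0l !addr0 ip0l mulr0.
have /cvg_norm := v0; rewrite normr0 => n0.
have n1 : `|v k| @[k --> U] --> (1 : R).
  by apply: (cvg_ext (h := fun=> 1)); [move=> k; rewrite v1|exact: cvg_cst].
by have /eqP : (1 : R) = 0 by [exact: (cvg_unique _ n1 n0)]; rewrite oner_eq0.
Qed.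

Lemma le_at0_of_quadratic (l b L Q : R) :
  (forall t, 0 < t <= 1 -> l <= b + t * L + t ^+ 2 * Q) -> l <= b.
Proof.
move=> h.
have cv : b + n.+1%:R^-1 * L + n.+1%:R^-1 ^+ 2 * Q @[n --> \oo]
    --> b + 0 * L + 0 ^+ 2 * Q.
  by apply: cvgD; [apply: cvgD; [exact: cvg_cst|]|];
    apply: cvgMl; [|apply: cvg_sqr]; exact: cvg_harmonic.
rewrite expr0n !mul0r !addr0 in cv.
apply: (cvgr_to_ge cv); apply: nearW => n; apply: h.
by rewrite invr_gt0 ltr0n /= invf_le1// ler1n.
Qed.

(** Points satisfying the constraints of [w] strictly are eventually feasible
    for [w' k], and under regularity they are dense in the feasible set of [w].
    So the limit [l] of the objective values is at most every feasible value,
    while a weak limit [z] of the solutions is feasible with value at most [l].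
    Hence [z] is a solution, its value is [l], and convergence is strong. *)
Lemma Sol_ultra_limit (I : Type) (U : set_system I) w a N
    (w' : I -> qp_data H m) (x : I -> H) : UltraFilter U ->
  Omega ip w -> 0 < a -> coercive_mod a (qpT w) -> regular_system ip w ->
  (forall k, Omega ip (w' k)) -> qp_dist (w' k) w @[k --> U] --> (0 : R) ->
  (forall k, Sol ip (w' k) (x k)) -> (forall k, `|x k| <= N) ->
  exists2 z, Sol ip w z & x @ U --> z.
Proof.
move=> UU Ow a0 coT [y0 y0_reg] Ow' e_cvg xSol xN.
have [cT sT TiP] := Ow.
have [z zP] := weak_ultra_limit UU xN.
pose e k := qp_dist (w' k) w.
have ec_cvg c : e k * c @[k --> U] --> (0 : R).
  by rewrite -(mul0r c); apply: cvgMl.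
have sq_le k : (1 + `|x k|) ^+ 2 <= (1 + N) ^+ 2.
  rewrite ler_sqr ?nnegrE ?lerD2l ?addr_ge0//.
  exact: le_trans (normr_ge0 (x k)) (xN k).
have e_sq k : e k * (1 + `|x k|) ^+ 2 <= e k * (1 + N) ^+ 2.
  by rewrite ler_wpM2l// qp_dist_ge0.
have [K K0 fK] := quad_bound (qpc w) 0 cT.
have f_bd k : `|objective ip w (x k)| <= K * (1 + N) ^+ 2.
  by rewrite objectiveE (le_trans (fK _))// ler_wpM2l.
have [l l_cvg] := ultra_cvg_bounded UU f_bd.
have wz : feasible ip w z.
  move=> i; have [_ sTi Ti0] := TiP i.
  apply: (quad_weak_lsc sTi (pos_semidef_coercive_mod Ti0) zP
    (ec_cvg ((1 + N) ^+ 2))).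
  apply: nearW => k; apply: le_trans (e_sq k).
  have /SolP[/(_ i) gx _] := xSol k.
  have := constraint_dist i (x k) (Ow' k) Ow; rewrite ler_norml -/(e k).
  by rewrite -[quad _ _ _ _]/(constraint ip w i (x k)) => /andP[+ _]; lra.
have l_strict y : (forall i, constraint ip w i y < 0) -> l <= objective ip w y.
  move=> y_lt.
  have y_feas : \forall k \near U, feasible ip (w' k) y.
    have : \forall k \near U, forall i : 'I_m, constraint ip (w' k) i y <= 0.
      apply: filter_forall => i.
      have lt0 : 0 < - constraint ip w i y by rewrite oppr_gt0.
      apply: filterS (cvgr_lt _ (ec_cvg ((1 + `|y|) ^+ 2)) _ lt0) => k.
      have := constraint_dist i y (Ow' k) Ow; rewrite ler_norml -/(e k).
      by move=> /andP[_ +]; lra.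
    by [].
  have r_cvg : objective ip w (x k) - e k * ((1 + N) ^+ 2 + (1 + `|y|) ^+ 2)
      @[k --> U] --> l.
    by rewrite -[X in _ --> X]subr0; apply: cvgB.
  apply: (cvgr_to_le r_cvg); apply: filterS y_feas => k yk.
  have /SolP[_ /(_ _ yk)] := xSol k.
  have := objective_dist (x k) (Ow' k) Ow.
  have := objective_dist y (Ow' k) Ow.
  have := e_sq k; rewrite !ler_norml -/(e k) mulrDr.
  by move=> h /andP[_ h1] /andP[h2 _]; lra.
(* [y] is approached along the segment towards the regular point [y0], whose
   points other than [y] satisfy the constraints strictly. *)
have l_feas y : feasible ip w y -> l <= objective ip w y.
  move=> wy; rewrite objectiveE.
  apply: (@le_at0_of_quadratic l _ (ip (qpT w y + qpc w) (y0 - y))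
    (2^-1 * ip (y0 - y) (qpT w (y0 - y)))) => t /andP[t0 t1].
  rewrite -quad_line// -objectiveE; apply: l_strict => i.
  have [_ sTi Ti0] := TiP i.
  have t01 : 0 <= t <= 1 by rewrite ltW.
  apply: le_lt_trans (quad_convex _ _ _ _ sTi Ti0 t01) _.
  have := wy i; have := y0_reg i.
  rewrite -![quad _ _ _ _]/(constraint ip w i _).
  nra.
have z_l : objective ip w z <= l.
  rewrite objectiveE.
  apply: (quad_weak_lsc sT (coercive_mod_le (ltW a0) coT) zP l_cvg).
  by apply: nearW => k; rewrite objectiveE.
exists z.
  by apply/SolP; split=> // y wy; exact: le_trans z_l (l_feas y wy).
apply: (quad_strong_cvg a0 sT coT zP l_cvg (b := qpc w) (g := 0)).
  by apply: nearW => k; rewrite objectiveE.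
by rewrite -objectiveE; exact: l_feas.
Qed.

(** * Necessity of the three conditions *)

Section Necessity.
Context w (Ow : Omega ip w) (Sol_w : Sol ip w !=set0)
  (lsc_w : lsc_at ip (Sol ip (m := m)) w).

Lemma lsc_Sol_nonempty : exists2 eps : R, 0 < eps &
  forall w', Omega ip w' -> qp_dist w' w < eps -> Sol ip w' !=set0.
Proof.
have [|eps eps0 epsP] := lsc_w openT; first by rewrite setIT.
by exists eps => // w' Ow' w'w; have := epsP _ Ow' w'w; rewrite setIT.
Qed.

Lemma opnorm_subrr (A : H -> H) e : 0 <= e -> opnorm (fun x => A x - A x) <= e.
Proof. by move=> e0; apply: opnorm_le => x _; rewrite subrr normr0. Qed.

(** Raising every [alpha_i] empties the feasible set of a system that is not
    regular. *)
Lemma lsc_regular : regular_system ip w.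
Proof.
have [eps eps0 epsP] := lsc_Sol_nonempty.
have e0 : 0 < eps / 2 by rewrite divr_gt0.
pose w' : qp_data H m := QPData (qpT w) (qpc w) (qpTi w) (qpci w)
  (fun i => qpalpha w i + eps / 2).
have w'w : qp_dist w' w <= eps / 2.
  have e0' := ltW e0.
  apply: qp_dist_le => [|||i|i|i] /=; rewrite ?opnorm_subrr ?subrr ?normr0//.
  by rewrite addrAC subrr add0r gtr0_norm.
have [|x [w'x _]] := epsP w' Ow.
  by apply: le_lt_trans w'w _; rewrite ltr_pdivrMr// ltr_pMr// ltr1n.
by exists x => i; have := w'x i; rewrite /constraint /= addrA; lra.
Qed.

(** If [y] is a second solution, adding [d (x - y)] to [c] penalizes [x]
    relative to [y]: no solution of the perturbed problem lies in the open
    half-space [<x - y, v> > <x - y, y>], which contains [x]. *)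
Lemma lsc_Sol_subsingleton x y : Sol ip w x -> Sol ip w y -> x = y.
Proof.
move=> xS yS; apply: contrapT => xy; pose u := x - y.
have u0 : 0 < ip u u.
  rewrite -ip_norm exprn_gt0// normr_gt0 subr_eq0; exact/eqP.
have V_open : open [set v | ip u y < ip u v].
  apply: (@open_comp _ _ (ip u) [set t | ip u y < t]); last exact: open_gt.
  by move=> v _; apply: ip_cvg; exact: cvg_id.
have [|eps eps0 epsP] := lsc_w V_open.
  by exists x; split=> //=; rewrite -subr_gt0 -ipNr -ipDr.
have nu : 0 < `|u| + 1 by rewrite ltr_wpDl.
pose d := eps / 2 / (`|u| + 1).
have d0 : 0 < d by rewrite !divr_gt0.
pose w' : qp_data H m :=
  QPData (qpT w) (qpc w + d *: u) (qpTi w) (qpci w) (qpalpha w).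
have e0 : 0 <= eps / 2 by rewrite divr_ge0// ltW.
have w'w : qp_dist w' w <= eps / 2.
  apply: qp_dist_le => [|||i|i|i] /=; rewrite ?opnorm_subrr ?subrr ?normr0//.
  rewrite addrAC subrr add0r normrZ gtr0_norm// mulrAC ler_pdivrMr//.
  by rewrite ler_wpM2l// lerDl.
have [|v [/SolP[wv vmin] /= uv]] := epsP w' Ow.
  by apply: le_lt_trans w'w _; rewrite ltr_pdivrMr// ltr_pMr// ltr1n.
have /SolP[wy ymin] := yS.
have := vmin y wy; have := ymin v wv.
rewrite /objective /= !ipDl !ipZl.
have : d * ip u y < d * ip u v by rewrite ltr_pM2l.
lra.
Qed.

(** Replacing [T] by [T - d id] makes the objective unbounded below along a
    nonzero recession direction [v] with [<v, T v> <= 0]. *)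
Lemma lsc_recession_pos v :
  recession_cone ip w v -> ip v (qpT w v) <= 0 -> v = 0.
Proof.
move=> v_rec vTv; apply: contrapT => v0.
have vv : 0 < ip v v by rewrite -ip_norm exprn_gt0// normr_gt0; exact/eqP.
have [eps eps0 epsP] := lsc_Sol_nonempty.
pose d := eps / 2; have d0 : 0 < d by rewrite divr_gt0.
pose w' : qp_data H m := QPData (qpT w \- ( *:%R d : {linear H -> H}))
  (qpc w) (qpTi w) (qpci w) (qpalpha w).
have Ow' : Omega ip w'.
  have [cT sT TiP] := Ow; split=> //= [x|x y].
    by apply: cvgB; [exact: cT|exact: scaler_continuous].
  by rewrite !ipE sT.
have w'w : qp_dist w' w <= d.
  have d0' := ltW d0.
  apply: qp_dist_le => [|||i|i|i] /=; rewrite ?opnorm_subrr ?subrr ?normr0//.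
  apply: opnorm_le => y y1; rewrite addrAC subrr add0r normrN normrZ.
  by rewrite gtr0_norm// ler_piMr.
have [|x /SolP[w'x xmin]] := epsP w' Ow'.
  by apply: le_lt_trans w'w _; rewrite ltr_pdivrMr// ltr_pMr// ltr1n.
pose L := ip (qpT w' x + qpc w') v; pose q := ip v (qpT w' v).
have q0 : q < 0.
  rewrite /q /= !ipE ltrBlDr add0r; apply: le_lt_trans vTv _.
  by rewrite mulr_gt0.
(* Along [v] the perturbed objective changes by [t L + t^2 q / 2]; this [t]
   makes it equal to [t (L - |L| - 1)], which is negative. *)
pose t := 2 * (`|L| + 1) / - q.
have t0 : 0 < t by rewrite divr_gt0 ?mulr_gt0 ?oppr_gt0// ltr_wpDl.
have : feasible ip w' (x + t *: v).
  move=> i; have [Tiv civ] := v_rec i.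
  have [_ _ /(_ i) [_ sTi _]] := Ow.
  rewrite -[constraint _ _ _ _]/(quad (qpTi w i) (qpci w i) (qpalpha w i) _).
  rewrite quad_line// ipDl sTi Tiv !ip0r add0r !mulr0 addr0.
  by apply: ler_wnDr; [rewrite pmulr_rle0|exact: w'x].
move=> /xmin; have [_ sT' _] := Ow'.
rewrite !objectiveE quad_line// -/L -/q -addrA lerDl.
have -> : t * L + t ^+ 2 * (2^-1 * q) = t * (L - `|L| - 1).
  by rewrite /t; field; rewrite lt_eqF.
rewrite pmulr_rge0//; have := ler_norm L; lra.
Qed.

End Necessity.

End InnerProduct.

(** * The characterization of lower semicontinuity *)

(* Sol w !=set0 accompanies lower semicontinuity: at a point where Sol is empty
   the open-set condition holds vacuously, yet Sol w is no singleton. *)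
Theorem theorem2p2 (R : realType) (H : completeNormedModType R)
    (ip : {dot H for idfun}) (ip_norm : induces_norm ip)
    (m : nat) (m_gt0 : (0 < m)%N)
    (w : qp_data H m) (wOmega : Omega ip w)
    (T_legendre : legendre_form ip (fun x => ip x (qpT w x))) :
  (Sol ip w !=set0 /\ lsc_at ip (Sol ip (m := m)) w) <->
  [/\ Sol_QPR ip w = [set 0],
      regular_system ip w &
      exists x : H, Sol ip w = [set x]].
Proof.
have rec0 : recession_cone ip w 0.
  by move=> i; rewrite linear0 ip0r.
split=> [[[x xS] w_lsc]|[qpr0 w_reg [x xS]]].
  have w_ne : Sol ip w !=set0 by exists x.
  split.
  - have rec_pos := lsc_recession_pos ip_norm wOmega w_ne w_lsc.
    apply/seteqP; split=> [v [v_rec vmin]|_ ->].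
      apply: rec_pos => //; have := vmin 0 rec0.
      by rewrite ip0l mulr0 pmulr_rle0.
    split=> // u u_rec; rewrite ip0l mulr0 leNgt; apply/negP => u_lt.
    have u0 : u = 0.
      apply: rec_pos => //; rewrite pmulr_rlt0// in u_lt; exact: ltW.
    by move: u_lt; rewrite u0 ip0l mulr0 ltxx.
  - exact: lsc_regular.
  - exists x; apply/seteqP; split=> [y yS|_ ->//].
    exact: (lsc_Sol_subsingleton ip_norm wOmega w_lsc yS xS).
split; first by exists x; rewrite xS.
have [cT sT TiP] := wOmega.
have [a a0 coT] := legendre_coercive_mod ip_norm cT T_legendre.
have rec_pos v : recession_cone ip w v -> ip v (qpT w v) <= 0 -> v = 0.
  move=> v_rec vTv; suff : Sol_QPR ip w v by rewrite qpr0.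
  split=> // u u_rec.
  have [_ /(_ u u_rec)] : Sol_QPR ip w 0 by rewrite qpr0.
  by rewrite ip0l mulr0; apply: le_trans; rewrite pmulr_rle0.
have [y0 y0_reg] := w_reg.
pose M := objective ip w y0 + 1.
have [eps eps0 [N NP]] := sublevel_bounded ip_norm M wOmega a0 coT rec_pos.
move=> V V_open [_ [/[1!xS] -> Vx]]; apply: contrapT => nV.
pose c := (1 + `|y0|) ^+ 2.
have c0 : 0 < c by rewrite exprn_gt0// ltr_pwDl.
(* Nearby problems inherit the weak lower semicontinuity of the objective, and
   the regular point [y0] stays feasible for them with value at most [M]. *)
have [del del0 delP] : exists2 del : R, 0 < del & forall w', Omega ip w' ->
    qp_dist w' w < del -> [/\ coercive_mod ip 0 (qpT w'), feasible ip w' y0,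
      objective ip w' y0 <= M & qp_dist w' w < eps].
  have gap0 i : 0 < - constraint ip w i y0 / c by rewrite divr_gt0// oppr_gt0.
  have : \forall del \near (0 : R)^'+,
      forall i, del < - constraint ip w i y0 / c.
    by apply: filter_forall => i; exact: nbhs_right_lt.
  move=> gap; near (0 : R)^'+ => del; exists del.
    by near: del; exact: nbhs_right_gt.
  move=> w' Ow' w'w.
  have w'c : qp_dist w' w * c < del * c by rewrite ltr_pM2r.
  split.
  - apply: (coercive_mod_le (a := a - del)).
      by rewrite subr_ge0 ltW//; near: del; exact: nbhs_right_lt.
    apply: (coercive_mod_perturb _ _ coT) => // y.
    by apply: le_trans (qpT_dist y Ow' wOmega) _; rewrite ler_wpM2r// ltW.
  - move=> i; have := constraint_dist ip_norm i y0 Ow' wOmega.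
    have : del < - constraint ip w i y0 / c by move: i; near: del.
    by rewrite ltr_pdivlMr// ler_norml -/c => h /andP[_ +]; lra.
  - have : del < 1 / c by near: del; apply: nbhs_right_lt; rewrite divr_gt0.
    have := objective_dist ip_norm y0 Ow' wOmega.
    by rewrite ltr_pdivlMr// ler_norml -/c => /andP[_ +] h; rewrite /M; lra.
  - by apply: lt_trans w'w _; near: del; exact: nbhs_right_lt.
have Sol_near w' : Omega ip w' -> qp_dist w' w < del ->
    exists2 z, Sol ip w' z & `|z| <= N.
  move=> Ow' /(delP _ Ow')[coT' y0_feas y0M w'eps].
  have [|z zS] := Sol_nonempty ip_norm (N := N) Ow' coT' y0_feas.
    by move=> z wz zy0; apply: (NP w') => //; exact: le_trans zy0 y0M.
  exists z => //; have /SolP[wz /(_ _ y0_feas) zy0] := zS.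
  by apply: (NP w') => //; exact: le_trans zy0 y0M.
(* If semicontinuity fails at [V], there are problems tending to [w] with
   solutions outside [V]. *)
have /choice [p pP] (k : nat) : exists p : qp_data H m * H,
    [/\ Omega ip p.1, qp_dist p.1 w < k.+1%:R^-1, Sol ip p.1 p.2,
        ~ V p.2 & `|p.2| <= N].
  apply: contrapT => np; apply: nV.
  exists (Num.min del k.+1%:R^-1).
    by rewrite lt_min del0 /= invr_gt0.
  move=> w' Ow'; rewrite lt_min => /andP[w'del w'k].
  have [z zS zN] := Sol_near w' Ow' w'del.
  exists z; split=> //; apply: contrapT => Vz; apply: np.
  by exists (w', z).
have [U [UU ooU]] := ultraFilterLemma (F := \oo) _.
have dist0 : qp_dist (p k).1 w @[k --> U] --> (0 : R).
  apply: (cvg_trans (cvg_app _ ooU)).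
  apply: (squeeze_cvgr _ (cvg_cst 0) cvg_harmonic).
  by apply: nearW => k; rewrite qp_dist_ge0 /= ltW//; have [] := pP k.
have [|||z zS zP] := Sol_ultra_limit ip_norm (N := N) (x := fun k => (p k).2)
  UU wOmega a0 coT w_reg _ dist0.
- by move=> k; have [] := pP k.
- by move=> k; have [] := pP k.
- by move=> k; have [] := pP k.
have zx : z = x by move: zS; rewrite xS.
have UV : U [set k | V (p k).2].
  by apply: zP; rewrite zx; exact: open_nbhs_nbhs.
have [k Vk] := filter_ex UV.
by have [_ _ _] := pP k.
Unshelve. all: by end_near. Qed.
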